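(* Let $\Gamma$ be a finite group. For every $n\ge1$ and all $\lambda,\mu\in\mathcal P(\Gamma_* )$, the graded $\mathbb Z$-ring $\mathcal G_\Gamma(n)$ has multiplication given by $$K_\lambda(n)\,K_\mu(n)=\sum_{\|\nu\|=\|\lambda\|+\|\mu\|}a_{\lambda\mu}^\nu\,K_\nu(n),$$ where the structure constants $a_{\lambda\mu}^\nu$ are nonnegative integers independent of $n$.
   Context: $\Gamma_*$ is the set of conjugacy classes of $\Gamma$, and $c^0=\{1\}$. $S_n$ acts on $\Gamma^n$ by $\sigma(g_1,\dots,g_n)=(g_{\sigma^{-1}(1)},\dots,g_{\sigma^{-1}(n)})$, and $\Gamma_n=\Gamma^n\rtimes S_n$ with $(g,\sigma)(h,\tau)=(g\,\sigma(h),\sigma\tau)$. For $x=(g,\sigma)$ and a cycle $(i_1\cdots i_k)$ of $\sigma$ (fixed points are 1-cycles), the cycle-product is $g_{i_k}\cdots g_{i_1}$, well defined up to conjugacy. $\mathcal P(\Gamma_* )$ is the set of partition-valued functions on $\Gamma_*$; $\|\lambda\|=\sum_c|\lambda(c)|$, and $\ell$ denotes the number of parts of a partition. The type $\rho$ of $x\in\Gamma_n$: the number of parts of $\rho(c)$ equal to $i$ is the number of $i$-cycles of $\sigma$ with cycle-product in $c$. The modified type $\lambda$: $\lambda(c)=\rho(c)$ for $c\ne c^0$, and $\lambda(c^0)$ is obtained from $\rho(c^0)$ by subtracting 1 from every part (zeros discarded). $K_\lambda(n)\in\mathbb Z[\Gamma_n]$ is the sum of all elements of $\Gamma_n$ of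 modified type $\lambda$; it is nonzero iff $\|\lambda\|+\ell(\lambda(c^0))\le n$, and the nonzero ones form a $\mathbb Z$-basis of the center $R_\mathbb{Z}(\Gamma_n)$ of $\mathbb Z[\Gamma_n]$. Assigning degree $\|\lambda\|$ to $K_\lambda(n)$ (i.e. letting the $k$-th filtration piece be the span of the $K_\lambda(n)$ with $\|\lambda\|\le k$) makes $R_\mathbb{Z}(\Gamma_n)$ a filtered ring; $\mathcal G_\Gamma(n)$ is the associated graded ring, and the image of $K_\lambda(n)$ in its degree $\|\lambda\|$ component is still denoted $K_\lambda(n)$. *)

(* Defs.v *)
From HB Require Import structures.
From mathcomp Require Import all_boot all_order all_fingroup all_algebra.
From mathcomp Require Import boolp classical_sets cardinality fsbigop.
Set Implicit Arguments. Unset Strict Implicit. Unset Printing Implicit Defensive.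
Import GRing.Theory.
Local Open Scope ring_scope.

Section GroupRing.
Variable G : finGroupType.

Definition group_ring := {ffun G -> int}.
HB.instance Definition _ := GRing.Zmodule.on group_ring.

Definition gr_delta (x : G) : group_ring := [ffun y => (y == x)%:R].
(* Elements of Z[G] are functions G -> int; the product is convolution. *)
Definition gr_mul (u v : group_ring) : group_ring :=
  [ffun x => \sum_(y : G) u y * v (y^-1 * x)%g].

Lemma gr_mulA : associative gr_mul.
Proof.
move=> u v w; apply/ffunP => x; rewrite !ffunE.
under eq_bigr do rewrite ffunE big_distrr /=.
under [RHS]eq_bigr do rewrite ffunE big_distrl /=.
rewrite [RHS]exchange_big /=; apply: eq_bigr => y _.
rewrite (reindex_inj (mulgI y^-1%g)) /=; apply: eq_bigr => z _.
by rewrite mulrA invMg invgK mulgA mulgK.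
Qed.

Lemma gr_mul1l : left_id (gr_delta 1%g) gr_mul.
Proof.
move=> u; apply/ffunP => x; rewrite !ffunE (bigD1 1%g) //= !ffunE eqxx invg1 !mul1r mul1g.
by rewrite big1 ?addr0 // => y /negPf y1; rewrite ffunE y1 mul0r.
Qed.

Lemma gr_mul1r : right_id (gr_delta 1%g) gr_mul.
Proof.
move=> u; apply/ffunP => x; rewrite !ffunE (bigD1 x) //= !ffunE mulVg eqxx mulr1.
rewrite big1 ?addr0 // => y /negPf yx; rewrite ffunE -eq_mulVg1 yx mulr0 //.
Qed.

Lemma gr_mulDl : left_distributive gr_mul +%R.
Proof.
move=> u v w; apply/ffunP => x; rewrite !ffunE -big_split /=.
by apply: eq_bigr => y _; rewrite !ffunE mulrDl.
Qed.

Lemma gr_mulDr : right_distributive gr_mul +%R.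
Proof.
move=> u v w; apply/ffunP => x; rewrite !ffunE -big_split /=.
by apply: eq_bigr => y _; rewrite !ffunE mulrDr.
Qed.

Lemma gr_1_neq0 : gr_delta 1%g != 0.
Proof. by apply/eqP => /ffunP/(_ 1%g); rewrite !ffunE eqxx. Qed.

HB.instance Definition _ := GRing.Zmodule_isNzRing.Build group_ring
  gr_mulA gr_mul1l gr_mul1r gr_mulDl gr_mulDr gr_1_neq0.

Definition central : {pred group_ring} :=
  fun u => `[< forall v : group_ring, u * v = v * u >].

Lemma centralP (u : group_ring) :
  reflect (forall v : group_ring, u * v = v * u) (u \in central).
Proof. exact: asboolP. Qed.

Lemma central_subring : subring_closed central.
Proof.
split=> [|u v /centralP cu /centralP cv|u v /centralP cu /centralP cv];
  apply/centralP => w.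
- by rewrite mul1r mulr1.
- by rewrite mulrBl mulrBr cu cv.
- by rewrite -mulrA cv !mulrA cu.
Qed.
HB.instance Definition _ :=
  GRing.isSubringClosed.Build group_ring central central_subring.

Record group_ring_center :=
  GroupRingCenter { center_val : group_ring; _ : center_val \in central }.
HB.instance Definition _ := [isSub for center_val].
HB.instance Definition _ := [Choice of group_ring_center by <:].
HB.instance Definition _ :=
  [SubChoice_isSubNzRing of group_ring_center by <:].

Lemma center_mulC : commutative (@GRing.mul group_ring_center).
Proof.
move=> u v; apply: val_inj; rewrite !rmorphM.
by case: u => u /= /centralP.
Qed.
HB.instance Definition _ :=
  GRing.PzRing_hasCommutativeMul.Build group_ring_center center_mulC.


Lemma gr_deltaM (u : group_ring) x y : (u * gr_delta y) x = u (x * y^-1)%g.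
Proof.
rewrite /GRing.mul /= ffunE (bigD1 (x * y^-1)%g) //= !ffunE.
rewrite invMg invgK mulgKV eqxx mulr1.
rewrite big1 ?addr0 // => z; rewrite ffunE eq_sym => /negPf zx.
suff -> : (z^-1 * x == y)%g = false by rewrite mulr0.
apply: contraFF zx => /eqP <-; by rewrite invMg invgK mulKVg.
Qed.

Lemma gr_mulM (u : group_ring) x y : (gr_delta y * u) x = u (y^-1 * x)%g.
Proof.
rewrite /GRing.mul /= ffunE (bigD1 y) //= !ffunE eqxx mul1r.
by rewrite big1 ?addr0 // => z /negPf zy; rewrite ffunE zy mul0r.
Qed.

Lemma central_classfun (u : group_ring) :
  reflect (forall x y : G, u (x ^ y)%g = u x) (u \in central).
Proof.
apply: (iffP (centralP u)) => [cu x y|cu v].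
  have /(congr1 (fun w : group_ring => w (x * y)%g)) := cu (gr_delta y).
  by rewrite gr_deltaM gr_mulM mulgK /conjg => ->.
apply/ffunP => x; rewrite /GRing.mul /= !ffunE.
rewrite (reindex_inj (@mulgI _ x)) /= (reindex_inj invg_inj) /=.
apply: eq_bigr => y _; rewrite invMg invgK mulgKV mulrC.
by rewrite -(cu (x * y^-1)%g y) /conjg !mulgA mulgKV.
Qed.

End GroupRing.

Record filtration (R : comNzRingType) := Filtration {
  fpiece :> nat -> {pred R};
  fpiece_zmod : forall k, zmod_closed (fpiece k);
  fpieceS : forall k, {subset fpiece k <= fpiece k.+1};
  fpiece1 : 1 \in fpiece 0;
  fpieceM : forall i j u v,
    u \in fpiece i -> v \in fpiece j -> u * v \in fpiece (i + j)%N
}.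

Section AssociatedGraded.
Variables (R : comNzRingType) (F : filtration R).

(* The associated graded ring of F is (+)_k F_k / F_(k-1), with F_(-1) = 0.
   Finitely supported sequences are encoded as polynomials p over R, with p`_k
   in degree k: the ring of the p with p`_k in F_k for all k (product
   (pq)_k = sum_(i+j=k) p_i q_j) is quotiented by the ideal of the p with
   p`_k in F_(k-1) for all k. *)
Definition fpiece_pred (k : nat) : {pred R} :=
  if k is k'.+1 then F k' else pred1 0.

Definition rees_pred : {pred {poly R}} := fun p => `[< forall k, p`_k \in F k >].

Lemma fpiece_sum k (I : Type) (r : seq I) (P : pred I) (E : I -> R) :
  (forall i, P i -> E i \in F k) -> \sum_(i <- r | P i) E i \in F k.
Proof.
move=> FE; have [F0 FB] := fpiece_zmod F k.
apply: (big_ind (fun u => u \in F k)) => // u v Fu Fv.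
by rewrite -[v]opprK FB // -[- v]sub0r FB.
Qed.

Lemma fpiece_le i j : (i <= j)%N -> {subset F i <= F j}.
Proof.
move=> /subnK <-; elim: (j - i)%N => // m IH u Fu.
by apply: fpieceS; exact: IH.
Qed.

Lemma fpiece_pred_zmod k : zmod_closed (fpiece_pred k).
Proof.
case: k => [|k]; last exact: fpiece_zmod.
by split=> [|u v /eqP-> /eqP->]; rewrite inE ?subrr.
Qed.

Lemma rees_subring : subring_closed rees_pred.
Proof.
split=> [|p q /asboolP Fp /asboolP Fq|p q /asboolP Fp /asboolP Fq];
  apply/asboolP => k.
- rewrite coef1; case: eqP => [->|_]; first exact: fpiece1.
  exact: (fpiece_zmod F k).1.
- by rewrite coefB; apply: (fpiece_zmod F k).2.
- rewrite coefM; apply: fpiece_sum => i _.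
  by have := fpieceM (Fp i) (Fq (k - i)%N); rewrite subnKC // -ltnS.
Qed.
HB.instance Definition _ :=
  GRing.isSubringClosed.Build {poly R} rees_pred rees_subring.

Record rees := Rees { rees_val : {poly R}; _ : rees_val \in rees_pred }.
HB.instance Definition _ := [isSub for rees_val].
HB.instance Definition _ := [Choice of rees by <:].
HB.instance Definition _ := [SubChoice_isSubComNzRing of rees by <:].

Definition rees_shift : {pred rees} :=
  fun p => `[< forall k, (val p)`_k \in fpiece_pred k >].

Lemma rees_shift_ideal : idealr_closed rees_shift.
Proof.
split=> [||a u v /asboolP Iu /asboolP Iv].
- by apply/asboolP => k; rewrite raddf0 coef0 (fpiece_pred_zmod k).1.
- apply/asboolP => /(_ 0%N); rewrite rmorph1 coef1 /= inE.
  by rewrite oner_eq0.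
- apply/asboolP => k; rewrite rmorphD rmorphM /= coefD.
  have [F0 FB] := fpiece_pred_zmod k.
  rewrite -[X in _ + X]opprK FB //; last by rewrite -sub0r FB.
  case: a => p /= /asboolP Fp; rewrite coefM; case: k Iu {Iv} F0 FB => [|k] Iu F0 FB /=.
    by rewrite big_ord1 (eqP (Iu 0%N)) mulr0.
  apply: fpiece_sum => i _; case: (ltnP i k.+1) => [ik|ki].
    have := Iu (k.+1 - i)%N; rewrite subSn //= => Iuk.
    by have := fpieceM (Fp i) Iuk; rewrite subnKC // -ltnS.
  have -> : (k.+1 - i = 0)%N by apply/eqP; rewrite subn_eq0.
  by rewrite (eqP (Iu 0%N)) mulr0.
Qed.
HB.instance Definition _ :=
  isIdealr.Build rees rees_shift rees_shift_ideal.

Definition assoc_graded := {ideal_quot rees_shift}.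
HB.instance Definition _ := GRing.ComNzRing.on assoc_graded.

Lemma monomial_rees k (u : R) : u \in F k -> u *: 'X^k \in rees_pred.
Proof.
move=> Fu; apply/asboolP => i; rewrite coefZ coefXn.
case: eqP => [->|_]; first by rewrite mulr1.
by rewrite mulr0 (fpiece_zmod F i).1.
Qed.

(* The image of u in F_k / F_(k-1), in degree k. *)
Definition graded_class k (u : R) (Fu : u \in F k) : assoc_graded :=
  \pi_assoc_graded%qT (Rees (monomial_rees Fu)).
End AssociatedGraded.
Section Transport.
Variables (T : finType) (s : {perm T}).

Lemma iter_mod i m : iter (m %% #|porbit s i|) s i = iter m s i.
Proof.
rewrite {2}(divn_eq m #|porbit s i|) addnC iterD; congr iter.
by elim: (m %/ _)%N => //= d IH; rewrite mulSn addnC iterD iter_porbit -IH.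
Qed.

Lemma iter_eq_mod i a b :
  iter a s i = iter b s i -> (a = b %[mod #|porbit s i|])%N.
Proof.
rewrite -iter_mod -(iter_mod i b) => e.
have k0 : (0 < #|porbit s i|)%N by rewrite lt0n card_porbit_neq0.
have /(nth_uniq i) := uniq_traject_porbit s i; rewrite size_traject.
move=> /(_ _ _ (ltn_pmod a k0) (ltn_pmod b k0)).
by rewrite !nth_traject ?ltn_pmod // e eqxx => /esym/eqP.
Qed.

Lemma periodic_mod (U : Type) (E : nat -> U) k m :
  (forall m, E (m + k)%N = E m) -> E (m %% k)%N = E m.
Proof.
move=> Ek; rewrite {2}(divn_eq m k) addnC.
by elim: (m %/ k)%N => [|d IH]; rewrite ?addn0 // mulSn addnC -addnA addnC Ek addnC.
Qed.

Lemma periodic_iter (U : Type) (E : nat -> U) i a b :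
  (forall m, E (m + #|porbit s i|)%N = E m) ->
  iter a s i = iter b s i -> E a = E b.
Proof. by move=> Ek /iter_eq_mod e; rewrite -(periodic_mod _ Ek) e periodic_mod. Qed.

Definition orep (O : {set T}) (i : T) : T := odflt i [pick j in O].

Lemma orep_porbit i j : orep (porbit s i) j \in porbit s i.
Proof.
rewrite /orep; case: pickP => [k //|/(_ i)].
by rewrite porbit_id.
Qed.

Lemma orep_irr (O : {set T}) i j k : k \in O -> orep O i = orep O j.
Proof. by rewrite /orep; case: pickP => // /(_ k) ->. Qed.

Lemma iter_mem m i : iter m s i \in porbit s i.
Proof. by rewrite -permX mem_porbit. Qed.

Lemma porbit_mem i j : j \in porbit s i -> porbit s j = porbit s i.
Proof. by rewrite -eq_porbit_mem => /eqP. Qed.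

Lemma porbit_iter m i : porbit s (iter m s i) = porbit s i.
Proof. exact/porbit_mem/iter_mem. Qed.

Lemma oidx_ex i : exists m, i == iter m s (orep (porbit s i) i).
Proof.
have := orep_porbit i i; rewrite porbit_sym => /porbitP[m e].
by exists m; rewrite -permX -e.
Qed.
Definition oidx i := xchoose (oidx_ex i).
Lemma oidxE i : iter (oidx i) s (orep (porbit s i) i) = i.
Proof. by rewrite -(eqP (xchooseP (oidx_ex i))). Qed.

End Transport.

Section Wreath.
Variables (gT : finGroupType) (n : nat).

(* G^n x| S_n with (g, s)(h, t) = (g s(h), s t) and s(h)_i = h_(s^-1(i)).
   Here s t is composition of functions (first t, then s), which for MathComp
   permutations is the product (t * s)%g. *)
Definition wreath : Type := ({ffun 'I_n -> gT} * 'S_n)%type.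
HB.instance Definition _ := Finite.on wreath.

Definition wr_one : wreath := ([ffun=> 1%g], 1%g).
Definition wr_mul (x y : wreath) : wreath :=
  ([ffun i => (x.1 i * y.1 (x.2^-1%g i))%g], (y.2 * x.2)%g).
Definition wr_inv (x : wreath) : wreath :=
  ([ffun i => ((x.1 (x.2 i))^-1)%g], (x.2^-1)%g).

Lemma wr_mulA : associative wr_mul.
Proof.
move=> [g s] [h t] [k u]; congr (_, _) => /=; last by rewrite mulgA.
by apply/ffunP => i; rewrite !ffunE /= invMg permM mulgA.
Qed.
Lemma wr_mul1 : left_id wr_one wr_mul.
Proof.
move=> [g s]; congr (_, _) => /=; last by rewrite mulg1.
by apply/ffunP => i; rewrite !ffunE /= invg1 perm1 mul1g.
Qed.
Lemma wr_mulV : left_inverse wr_one wr_inv wr_mul.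
Proof.
move=> [g s]; congr (_, _) => /=; last by rewrite mulgV.
by apply/ffunP => i; rewrite !ffunE /= invgK mulVg.
Qed.
HB.instance Definition _ := Finite_isGroup.Build wreath wr_mulA wr_mul1 wr_mulV.

Lemma wrM1 (x y : wreath) i : (x * y)%g.1 i = (x.1 i * y.1 (x.2^-1%g i))%g.
Proof. by rewrite ffunE. Qed.
Lemma wrM2 (x y : wreath) i : (x * y)%g.2 i = x.2 (y.2 i).
Proof. by rewrite permM. Qed.

(* g_(i_k) ... g_(i_1) for the cycle (i_1 ... i_k) of x.2 with i_1 = i: traject
   lists i, s(i), ..., s^(k-1)(i). *)
Definition cycle_product (x : wreath) (i : 'I_n) : gT :=
  (\prod_(j <- rev (traject x.2 i #|porbit x.2 i|)) x.1 j)%g.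

(* g_(s^m(i)) ... g_(s(i)), where s = x.2. *)
Fixpoint transport (x : wreath) i m : gT :=
  if m is m'.+1 then (x.1 (iter m'.+1 x.2 i) * transport x i m')%g else 1%g.
Definition holonomy x i := transport x i #|porbit x.2 i|.

Lemma transportD x i a b :
  transport x i (a + b) = (transport x (iter a x.2 i) b * transport x i a)%g.
Proof.
elim: b => [|b IH]; first by rewrite addn0 mul1g.
by rewrite addnS /= IH mulgA -iterD addnC.
Qed.

Lemma transport_rev x i m :
  transport x i m = (\prod_(j <- rev (traject x.2 (x.2 i) m)) x.1 j)%g.
Proof.
elim: m => [|m IH]; first by rewrite big_nil.
by rewrite trajectSr rev_rcons big_cons -IH -iterSr.
Qed.

Lemma cycle_product_holonomy x i : cycle_product x (x.2 i) = holonomy x i.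
Proof.
by rewrite /cycle_product /holonomy transport_rev (porbit_iter x.2 1 i).
Qed.

Lemma transport_period x i m :
  transport x i (m + #|porbit x.2 i|)%N = (transport x i m * holonomy x i)%g.
Proof. by rewrite addnC transportD iter_porbit. Qed.

Lemma holonomy_iter x i m :
  (holonomy x (iter m x.2 i) * transport x i m = transport x i m * holonomy x i)%g.
Proof.
by rewrite /holonomy porbit_iter -transportD transport_period.
Qed.

Lemma holonomy_conj x i j : j \in porbit x.2 i ->
  exists a, holonomy x j = (a * holonomy x i * a^-1)%g.
Proof.
move=> /porbitP[m ->]; rewrite permX; exists (transport x i m).
by rewrite -holonomy_iter mulgK.
Qed.

Lemma holonomy_class x i j : j \in porbit x.2 i ->
  (holonomy x j ^: [set: gT] = holonomy x i ^: [set: gT])%g.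
Proof.
move=> /holonomy_conj[a ->]; apply/eqP; rewrite eq_sym; apply/eqP/class_eqP.
apply/imsetP; exists a; rewrite ?inE //.
by rewrite /conjg !mulgA mulVg mul1g mulgKV.
Qed.
End Wreath.
Record intpartn := IntPartn {
  parts :> seq nat;
  _ : sorted geq parts && (0%N \notin parts)
}.
HB.instance Definition _ := [isSub for parts].
HB.instance Definition _ := [Choice of intpartn by <:].

Lemma to_partn_subproof (s : seq nat) :
  let t := sort geq [seq k <- s | (0 < k)%N] in sorted geq t && (0%N \notin t).
Proof.
rewrite /= mem_sort mem_filter andbT.
by apply: sort_sorted => a b; exact: leq_total.
Qed.
(* The partition whose parts are the nonzero entries of s. *)
Definition to_partn (s : seq nat) : intpartn := IntPartn (to_partn_subproof s).

Lemma to_partn_perm s t :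
  (to_partn s == to_partn t) = perm_eq [seq k <- s | (0 < k)%N] [seq k <- t | (0 < k)%N].
Proof.
have tot : total geq by move=> a b; exact: leq_total.
have tr : transitive geq by move=> a b c ba cb; exact: leq_trans cb ba.
have asym : antisymmetric geq.
  by move=> a b /andP[ba ab]; apply: anti_leq; apply/andP.
apply/eqP/(perm_sortP tot tr asym) => [[]|e] //.
by apply: val_inj.
Qed.

Lemma parts_to_partn s : perm_eq (to_partn s) [seq k <- s | (0 < k)%N].
Proof. by rewrite perm_sort. Qed.

Lemma sumn_pos s : sumn [seq k <- s | (0 < k)%N] = sumn s.
Proof. by elim: s => //= -[|k] s /= ->. Qed.

Lemma sumn_to_partn s : sumn (to_partn s) = sumn s.
Proof. by rewrite (perm_sumn (parts_to_partn s)) sumn_pos. Qed.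

Lemma perm_predn (s t : seq nat) :
  0%N \notin s -> 0%N \notin t -> size s = size t ->
  perm_eq [seq k <- [seq k.-1 | k <- s] | (0 < k)%N]
          [seq k <- [seq k.-1 | k <- t] | (0 < k)%N] ->
  perm_eq s t.
Proof.
move=> s0 t0 sst pst.
pose P := map predn; have PK u : 0%N \notin u -> map S (P u) = u.
  by elim: u => //= -[|k] u IH; rewrite inE //= => /IH ->.
suff /(perm_map S) : perm_eq (P s) (P t) by rewrite !PK.
have PE u : perm_eq (P u) ([seq k <- P u | (0 < k)%N] ++
    nseq (size u - size [seq k <- P u | (0 < k)%N]) 0%N).
  rewrite perm_sym -(permPr (introT permPl (perm_filterC (fun k => 0 < k)%N (P u)))).
  rewrite perm_cat2l.
  have -> : (size u - size [seq k <- P u | (0 < k)%N])%N =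
    size [seq k <- P u | predC (fun k => (0 < k)%N) k].
    by rewrite -(size_map predn u) -/(P u) -(count_predC (fun k => 0 < k)%N (P u))
         !size_filter addKn.
  by elim: (P u) => //= -[|k] v IH //=; rewrite perm_cons.
rewrite (permPl (PE s)) perm_sym (permPl (PE t)) perm_sym sst (perm_size pst).
by rewrite perm_cat2r.
Qed.

Definition conj_class (gT : finGroupType) : Type :=
  {c : {set gT} | c \in classes [set: gT]}.
HB.instance Definition _ gT := SubFinite.on (conj_class gT).
Definition class1 (gT : finGroupType) : conj_class gT := exist _ 1%g (classes1 _).

Definition partn_fun (gT : finGroupType) : Type := {ffun conj_class gT -> intpartn}.
HB.instance Definition _ gT := Choice.on (partn_fun gT).

Definition partn_norm gT (lam : partn_fun gT) : nat :=
  (\sum_(c : conj_class gT) sumn (lam c))%N.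

Section Types.
Variables (gT : finGroupType) (n : nat).
Implicit Types x y : wreath gT n.

(* A cycle of x.2 is represented by its support. The cycle-products for the
   different starting points of a cycle are conjugate, so "for some i in the
   cycle" amounts to "for all i in the cycle" (see cycles_inE). *)
Definition cycles_in x (c : conj_class gT) : {set {set 'I_n}} :=
  [set O in porbits x.2 | [exists i in O, cycle_product x i \in val c]].

Definition wr_type x : partn_fun gT :=
  [ffun c => to_partn [seq #|C| | C : {set 'I_n} in cycles_in x c]].

Definition modified_type x : partn_fun gT :=
  [ffun c => if c == class1 gT then to_partn [seq k.-1 | k <- wr_type x c]
             else wr_type x c].

Lemma hclass_subproof x i :
  (holonomy x i ^: [set: gT])%g \in classes [set: gT].
Proof. by rewrite mem_classes ?inE. Qed.
Definition hclass x i : conj_class gT :=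
  exist (fun c => c \in classes [set: gT]) _ (hclass_subproof x i).

Lemma hclass_orbit x i j : j \in porbit x.2 i -> hclass x j = hclass x i.
Proof. by move=> ij; apply: val_inj; rewrite /= (holonomy_class ij). Qed.

Lemma cycles_inE x c i :
  (porbit x.2 i \in cycles_in x c) = (hclass x i == c).
Proof.
rewrite inE imset_f //=; apply/existsP/eqP => [[j /andP[ij jc]]|<-].
  move: ij jc; rewrite -(permKV x.2 j) cycle_product_holonomy => ij jc.
  have ij' : x.2^-1%g j \in porbit x.2 i.
    rewrite -(porbit_mem ij) porbit_sym.
    exact: (iter_mem x.2 1 (x.2^-1%g j)).
  rewrite -(hclass_orbit ij'); apply: val_inj => /=.
  case: c jc => /= c /imsetP[a _ ->] /class_eqP -> //.
exists (x.2 i); rewrite cycle_product_holonomy /= class_refl.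
by rewrite (iter_mem _ 1).
Qed.

Lemma cycles_in_porbit x c O : O \in cycles_in x c -> exists i, O = porbit x.2 i.
Proof. by rewrite inE => /andP[/imsetP[i _ ->] _]; exists i. Qed.

Lemma cycles_pos x c : 0%N \notin [seq #|C| | C : {set 'I_n} in cycles_in x c].
Proof.
apply/negP => /mapP[O]; rewrite mem_enum => /cycles_in_porbit[i ->] /eqP.
by rewrite eq_sym (negPf (card_porbit_neq0 _ _)).
Qed.

Lemma filter_pos (s : seq nat) : 0%N \notin s -> [seq k <- s | (0 < k)%N] = s.
Proof.
move=> s0; apply/all_filterP/allP => k ks; rewrite lt0n.
by apply: contraNneq s0 => <-.
Qed.

Lemma wr_type_perm x c :
  perm_eq (wr_type x c) [seq #|C| | C : {set 'I_n} in cycles_in x c].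
Proof. by rewrite ffunE -[X in perm_eq _ X]filter_pos ?cycles_pos // parts_to_partn. Qed.

(* The number of cycles with trivial cycle-product. *)
Definition nbal x := #|cycles_in x (class1 gT)|.

Lemma sumn_image (T : finType) (A : {set T}) (f : T -> nat) :
  sumn [seq f a | a in A] = (\sum_(a in A) f a)%N.
Proof. by rewrite sumnE big_map big_enum. Qed.

Lemma norm_nbal x : (partn_norm (modified_type x) + nbal x)%N = n.
Proof.
have <- : (\sum_(O in porbits x.2) #|O|)%N = n.
  under eq_bigr => O _ do rewrite -sum1_card.
  rewrite (exchange_big_dep xpredT) //= -[RHS]card_ord -sum1_card.
  apply: eq_bigr => i _; rewrite (big_pred1 (porbit x.2 i)) // => O.
  apply/andP/eqP => [[/imsetP[j _ ->] /porbit_mem] //|->].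
  by rewrite porbit_id imset_f.
have -> : (\sum_(O in porbits x.2) #|O| =
   \sum_(c : conj_class gT) \sum_(O in cycles_in x c) #|O|)%N.
  rewrite (exchange_big_dep (mem (porbits x.2))) /=; last first.
    by move=> c O _; rewrite inE => /andP[].
  apply: eq_bigr => O /imsetP[i _ ->].
  under eq_bigl => c do rewrite cycles_inE eq_sym.
  by rewrite big_pred1_eq.
rewrite /partn_norm (bigD1 (class1 gT)) // [RHS](bigD1 (class1 gT)) //=.
rewrite addnAC; congr addn; last first.
  apply: eq_bigr => c /negPf c1.
  by rewrite ffunE c1 (perm_sumn (wr_type_perm x c)) sumn_image.
rewrite ffunE eqxx sumn_to_partn (perm_sumn (perm_map _ (wr_type_perm x _))).
rewrite -map_comp sumn_image /nbal -sum1_card -big_split /=.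
apply: eq_bigr => O /cycles_in_porbit[i ->].
by rewrite addn1 prednK // lt0n card_porbit_neq0.
Qed.

End Types.
Section Conjugacy.
Variables (gT : finGroupType) (n : nat).
Implicit Types x y z : wreath gT n.

Lemma perm_enum_imset (T : finType) (U : eqType) (f : T -> T) (g : T -> U)
    (A : {set T}) : {in A &, injective f} ->
  perm_eq [seq g a | a in f @: A] [seq g (f a) | a in A].
Proof.
move=> injf; have : perm_eq (enum (f @: A)) [seq f a | a in A].
  apply: uniq_perm; rewrite ?enum_uniq //.
    by rewrite map_inj_in_uniq ?enum_uniq // => a b; rewrite !mem_enum; apply: injf.
  move=> b; rewrite mem_enum; apply/imsetP/mapP => -[a aA ->]; exists a => //.
    by rewrite mem_enum.
  by rewrite -mem_enum.
by move=> /(perm_map g); rewrite /image_mem -map_comp.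
Qed.

Section Intertwine.
Variables x y z : wreath gT n.
Hypothesis xz : (y * x = z * y)%g.

Lemma intertw_perm m i : iter m z.2 (y.2 i) = y.2 (iter m x.2 i).
Proof.
elim: m => //= m ->; rewrite -!wrM2.
by rewrite -xz.
Qed.

Lemma intertw_transport m i :
  (transport z (y.2 i) m * y.1 (y.2 i) =
   y.1 (y.2 (iter m x.2 i)) * transport x i m)%g.
Proof.
elim: m => [|m IH] /=; first by rewrite mul1g mulg1.
rewrite -mulgA IH !mulgA; congr mulg.
have := congr1 (fun w : wreath gT n => w.1 (y.2 (iter m.+1 x.2 i))) xz.
by rewrite !wrM1 permK -!intertw_perm /= permK.
Qed.

Lemma intertw_porbit i : porbit z.2 (y.2 i) = y.2 @: porbit x.2 i.
Proof.
apply/setP => j; apply/porbitP/imsetP => [[m ->]|[k /porbitP[m ->] ->]].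
  exists ((x.2 ^+ m)%g i); first exact: mem_porbit.
  by rewrite !permX intertw_perm.
by exists m; rewrite !permX intertw_perm.
Qed.

Lemma intertw_hclass i : hclass z (y.2 i) = hclass x i.
Proof.
apply: val_inj => /=; apply/class_eqP; apply/imsetP.
exists (y.1 (y.2 i))^-1%g; rewrite ?inE //.
apply: (mulIg (y.1 (y.2 i))); rewrite /conjg invgK mulgA mulgKV.
rewrite /holonomy intertw_porbit card_imset; last exact: perm_inj.
by rewrite intertw_transport iter_porbit.
Qed.

Lemma intertw_cycles c : cycles_in z c = (fun C : {set 'I_n} => y.2 @: C) @: cycles_in x c.
Proof.
apply/setP => C; apply/idP/imsetP => [Cz|[D Dx ->]].
  have [j eC] := cycles_in_porbit Cz; move: Cz; rewrite eC -(permKV y.2 j).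
  rewrite intertw_porbit -intertw_porbit cycles_inE intertw_hclass => h.
  by exists (porbit x.2 (y.2^-1%g j)); rewrite ?cycles_inE // intertw_porbit.
have [i eD] := cycles_in_porbit Dx; move: Dx; rewrite eD -intertw_porbit.
by rewrite !cycles_inE intertw_hclass.
Qed.

Lemma intertw_type : modified_type z = modified_type x.
Proof.
suff et : wr_type z = wr_type x by rewrite /modified_type et.
apply/ffunP => c; rewrite !ffunE; apply/eqP; rewrite to_partn_perm.
apply: perm_filter; rewrite intertw_cycles.
apply: perm_trans (perm_enum_imset _ _) _.
  by move=> A B _ _; apply: imset_inj; exact: perm_inj.
have e (C : {set 'I_n}) : #|y.2 @: C| = #|C| by rewrite card_imset //; exact: perm_inj.
by rewrite /image_mem (eq_map e).
Qed.
End Intertwine.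

Lemma modified_typeJ x y : modified_type (x ^ y)%g = modified_type x.
Proof. by apply/esym/(@intertw_type _ y); rewrite mulKVg. Qed.

End Conjugacy.
Lemma matching (T : finType) (U : eqType) (A B : {set T}) (f g : T -> U) :
  (forall u, #|[set a in A | f a == u]| = #|[set b in B | g b == u]|) ->
  exists2 phi : T -> T, (forall a, a \in A -> phi a \in B /\ g (phi a) = f a) &
    {in A &, injective phi}.
Proof.
move=> eAB; pose Af u := [set a in A | f a == u]; pose Bg u := [set b in B | g b == u].
pose phi a := nth a (enum (Bg (f a))) (index a (enum (Af (f a)))).
have idx a : a \in A -> (index a (enum (Af (f a))) < size (enum (Bg (f a))))%N.
  by move=> aA; rewrite -cardE -eAB cardE index_mem mem_enum inE aA eqxx.
have phiB a : a \in A -> phi a \in Bg (f a).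
  by move=> aA; rewrite -mem_enum mem_nth ?idx.
exists phi => [a aA|a b aA bA e].
  by have := phiB a aA; rewrite inE => /andP[-> /eqP].
have fab : f a = f b.
  have := phiB a aA; have := phiB b bA; rewrite -e !inE.
  by move=> /andP[_ /eqP <-] /andP[_ /eqP].
move: e; rewrite /phi fab => /eqP.
rewrite (set_nth_default b) -?fab ?idx // nth_uniq ?enum_uniq ?idx //; last by rewrite fab idx.
have h c : c \in A -> f c = f a -> nth b (enum (Af (f a))) (index c (enum (Af (f a)))) = c.
  by move=> cA fc; rewrite nth_index // mem_enum inE cA fc eqxx.
by move=> /eqP ei; rewrite -(h a aA erefl) ei h.
Qed.

Section SameType.
Variables (gT : finGroupType) (n : nat).
Implicit Types x y z : wreath gT n.

Lemma cycles_card x z c k : modified_type x = modified_type z ->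
  #|[set C in cycles_in x c | #|C| == k]| = #|[set C in cycles_in z c | #|C| == k]|.
Proof.
move=> e; suff : perm_eq [seq #|C| | C : {set 'I_n} in cycles_in x c]
                        [seq #|C| | C : {set 'I_n} in cycles_in z c].
  move=> /seq.permP/(_ (pred1 k)); rewrite !count_map => ec.
  have h w : #|[set C in cycles_in w c | #|C| == k]| =
     count (preim (fun C : {set 'I_n} => #|C|) (pred1 k)) (enum (cycles_in w c)).
    rewrite -size_filter -(card_uniqP (filter_uniq _ (enum_uniq _))).
    by apply: eq_card => C; rewrite inE [RHS]mem_filter mem_enum andbC.
  by rewrite !h.
have en : nbal x = nbal z.
  by apply: (@addnI (partn_norm (modified_type x))); rewrite {2}e !norm_nbal.
move: e => /ffunP/(_ c); rewrite [LHS]ffunE [RHS]ffunE; case: eqP => [->|_] ec; last first.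
  by rewrite -(permPl (wr_type_perm x c)) -(permPr (wr_type_perm z c)) ec.
apply: perm_predn; rewrite ?cycles_pos //.
  by rewrite !size_map -!cardE.
move/eqP: ec; rewrite to_partn_perm => h.
apply: perm_trans (perm_trans h _).
  by apply/perm_filter/perm_map; rewrite perm_sym wr_type_perm.
by apply/perm_filter/perm_map; rewrite wr_type_perm.
Qed.

Definition oclass x (C : {set 'I_n}) : conj_class gT :=
  if [pick i in C] is Some i then hclass x i else class1 gT.
Lemma oclassE x i : oclass x (porbit x.2 i) = hclass x i.
Proof.
rewrite /oclass; case: pickP => [j /hclass_orbit //|/(_ i)].
by rewrite porbit_id.
Qed.

Lemma same_type_orbits x z : modified_type x = modified_type z ->
  exists2 phi : {set 'I_n} -> {set 'I_n},
   (forall C, C \in porbits x.2 ->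
      phi C \in porbits z.2 /\ (#|phi C|, oclass z (phi C)) = (#|C|, oclass x C)) &
   {in porbits x.2 &, injective phi}.
Proof.
move=> e; pose F (w : wreath gT n) (C : {set 'I_n}) := (#|C|, oclass w C).
apply: (@matching _ _ _ _ (F x) (F z)) => -[k c].
have h w : [set C in porbits w.2 | F w C == (k, c)] = [set C in cycles_in w c | #|C| == k].
  apply/setP => C; rewrite inE [RHS]inE andbC [RHS]andbC xpair_eqE -andbA.
  case: (#|C| == k) => //=; apply/andP/idP => [[+ /imsetP[i _ eC]]|Cw].
    by rewrite eC oclassE cycles_inE.
  have [i eC] := cycles_in_porbit Cw; move: Cw; rewrite eC oclassE cycles_inE imset_f //.
by rewrite !h; apply: cycles_card.
Qed.

Lemma same_type_conj x z : modified_type x = modified_type z ->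
  exists y, z = (x ^ y)%g.
Proof.
move=> /same_type_orbits[phi phiP phi_inj].
pose O i := porbit x.2 i; have Oin i : O i \in porbits x.2 by rewrite imset_f.
pose r i := orep (O i) i; pose r' i := orep (phi (O i)) i.
have rin i : r i \in O i by exact: orep_porbit.
have phiE i : phi (O i) = porbit z.2 (r' i).
  have [/imsetP[j _ e] _] := phiP _ (Oin i).
  by rewrite /r' e; apply/esym/porbit_mem/orep_porbit.
have cardE i : #|porbit z.2 (r' i)| = #|O i|.
  by have [_ [<- _]] := phiP _ (Oin i); rewrite phiE.
have clE i : hclass z (r' i) = hclass x (r i).
  have [_ [_]] := phiP _ (Oin i); rewrite phiE oclassE => ->.
  by rewrite oclassE (hclass_orbit (rin i)).
have aP i : exists a, holonomy z (r' i) == (a * holonomy x (r i) * a^-1)%g.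
  have /(congr1 val)/= /class_eqP/imsetP[a _ ->] := clE i.
  by exists a^-1%g; rewrite invgK /conjg mulgA.
pose a i := xchoose (aP i).
pose m i := oidx x.2 i.
have mE i : iter (m i) x.2 (r i) = i by exact: oidxE.
have OrE i : porbit x.2 (r i) = O i by exact: porbit_mem.
have same i j : O i = O j -> [/\ r i = r j, r' i = r' j & a i = a j].
  move=> e; have er : r i = r j.
    by rewrite /r e; apply: (@orep_irr _ _ _ _ j); rewrite porbit_id.
  have er' : r' i = r' j.
    by rewrite /r' e; apply: (@orep_irr _ _ _ _ (r' j)); rewrite phiE porbit_id.
  split=> //; rewrite /a; apply: eq_xchoose => b; by rewrite er er'.
pose tau i := iter (m i) z.2 (r' i).
have tau_orb i : porbit z.2 (tau i) = phi (O i) by rewrite porbit_iter -phiE.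
have tau_inj : injective tau.
  move=> i j e; have eO : O i = O j.
    by apply: phi_inj; rewrite ?Oin // -!tau_orb e.
  have [er er' _] := same _ _ eO.
  move: e; rewrite /tau er' => /iter_eq_mod; rewrite cardE -OrE => em.
  by rewrite -(mE i) -(mE j) er -iter_mod em iter_mod.
have OS i : O (x.2 i) = O i by exact: (porbit_iter x.2 1 i).
have step i : iter (m (x.2 i)) x.2 (r i) = iter (m i).+1 x.2 (r i).
  by have [er _ _] := same _ _ (OS i); rewrite -{1}er mE iterS mE.
pose E i k := (transport z (r' i) k * a i * (transport x (r i) k)^-1)%g.
have E_per i k : E i (k + #|porbit x.2 (r i)|)%N = E i k.
  rewrite /E transport_period OrE -cardE transport_period.
  rewrite (eqP (xchooseP (aP i))) -/(a i) invMg !mulgA !mulgKV.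
  by rewrite mulgK.
pose H i := E i (m i).
have tauS i : tau (x.2 i) = z.2 (tau i).
  have [er er' ea] := same _ _ (OS i).
  rewrite -[RHS]iterS /tau er'.
  apply: (periodic_iter (E := fun k => iter k z.2 (r' i))) (step i).
  by move=> k; rewrite OrE -cardE iterD iter_porbit.
have HS i : (H (x.2 i) * x.1 (x.2 i) = z.1 (tau (x.2 i)) * H i)%g.
  have [er er' ea] := same _ _ (OS i).
  rewrite /H (_ : E (x.2 i) = E i); last by rewrite /E er er' ea.
  rewrite (periodic_iter (E_per i) (step i)) /E /= invMg mE tauS.
  by rewrite !mulgA mulgKV.
pose t := perm tau_inj.
pose y : wreath gT n := ([ffun j => H (t^-1%g j)], t).
exists y^-1%g; rewrite /conjg invgK.
apply: (mulIg y); rewrite mulgA mulgKV; apply/esym.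
have e2 : (y * x)%g.2 = (z * y)%g.2.
  by apply/permP => i; rewrite !wrM2 /= !permE tauS.
rewrite [LHS]surjective_pairing [RHS]surjective_pairing e2; congr pair.
apply/ffunP => j; rewrite !wrM1 !ffunE.
have [i ->] : exists i, j = t (x.2 i) by exists (x.2^-1%g (t^-1%g j)); rewrite !permKV.
set j0 := t _; have -> : (t^-1)%g j0 = x.2 i by exact: permK.
rewrite HS /j0 permE; congr mulg; congr H.
by rewrite tauS permK -(permE tau_inj) permK.
Qed.
End SameType.
Section Subadditivity.
Variables (gT : finGroupType) (n : nat).
Implicit Types x y z r : wreath gT n.

Definition oact (a : gT) (o : option gT) : option gT := omap (mulg a) o.
Lemma oactM a b o : oact (a * b)%g o = oact a (oact b o).
Proof. by case: o => //= c; rewrite mulgA. Qed.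
Lemma oact1 o : oact 1%g o = o.
Proof. by case: o => //= c; rewrite mul1g. Qed.

(* Elements of (G + {0})^n, with 0 encoded as None; G acts on G + {0} by left
   multiplication. The number of fixed configurations of x is
   (#|G| + 1) ^ nbal x (card_wfix), from which the subadditivity of the norm
   (norm_mul) is deduced. *)
Definition config := {ffun 'I_n -> option gT}.
Implicit Types f u : config.

Definition wact x f : config := [ffun k => oact (x.1 k) (f (x.2^-1%g k))].
Lemma wactM x y f : wact (x * y)%g f = wact x (wact y f).
Proof. by apply/ffunP => k; rewrite !ffunE oactM /= invMg permM. Qed.
Lemma wact1 f : wact 1%g f = f.
Proof. by apply/ffunP => k; rewrite !ffunE oact1 /= invg1 perm1. Qed.

Definition wfix x : {set config} := [set f | wact x f == f].

Lemma wfixP x f :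
  reflect (forall k, f (x.2 k) = oact (x.1 (x.2 k)) (f k)) (f \in wfix x).
Proof.
rewrite inE; apply: (iffP eqP) => [e k|e].
  by rewrite -{1}e ffunE permK.
apply/ffunP => k; have [j ->] : exists j, k = x.2 j by exists (x.2^-1%g k); rewrite permKV.
by rewrite ffunE e permK.
Qed.

Lemma wfixM x y f : f \in wfix x -> f \in wfix y -> f \in wfix (x * y)%g.
Proof. by rewrite !inE wactM => /eqP fx /eqP ->; rewrite fx. Qed.
Lemma wfixV x f : f \in wfix x -> f \in wfix x^-1%g.
Proof. by rewrite !inE => /eqP e; rewrite -{1}e -wactM mulVg wact1. Qed.

Lemma wfix_transport x f i m : f \in wfix x ->
  f (iter m x.2 i) = oact (transport x i m) (f i).
Proof.
move=> /wfixP fx; elim: m => [|m IH]; first by rewrite oact1.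
by rewrite /= oactM -IH fx.
Qed.

Lemma hclass1 x i : (hclass x i == class1 gT) = (holonomy x i == 1%g).
Proof.
apply/eqP/eqP => [/(congr1 val)/= e|e].
  by apply/set1P; rewrite -[[set 1%g]]e class_refl.
by apply: val_inj; rewrite /= e class1G.
Qed.

Lemma unbalanced x f i : f \in wfix x -> holonomy x i != 1%g -> f i = None.
Proof.
move=> fx; apply: contraNeq => fi.
have := wfix_transport i #|porbit x.2 i| fx; rewrite iter_porbit -/(holonomy x i).
by case: (f i) fi => //= a _ [e]; rewrite (mulIg a (holonomy x i) 1%g) // mul1g.
Qed.

Lemma balanced_transport x i a b : holonomy x i = 1%g ->
  iter a x.2 i = iter b x.2 i -> transport x i a = transport x i b.
Proof.
move=> h; apply: periodic_iter => m.
by rewrite transport_period h mulg1.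
Qed.

Lemma card_wfix x : #|wfix x| = (#|{: option gT}| ^ nbal x)%N.
Proof.
pose B := cycles_in x (class1 gT).
have BE i : (porbit x.2 i \in B) = (holonomy x i == 1%g).
  by rewrite /B cycles_inE hclass1.
pose phi f : {ffun {set 'I_n} -> option gT} :=
  [ffun C : {set 'I_n} => if C \in B then
    (if [pick i in C] is Some i then f i else None) else None].
have phi_inj : {in wfix x &, injective phi}.
  move=> f u fx ux e; apply/ffunP => i.
  have [h|h] := eqVneq (holonomy x i) 1%g; last by rewrite !(@unbalanced x).
  have := congr1 (fun v : {ffun {set 'I_n} -> option gT} => v (porbit x.2 i)) e.
  rewrite !ffunE BE h eqxx; case: pickP => [j|/(_ i)]; last by rewrite porbit_id.
  rewrite porbit_sym => /porbitP[m ->] ej.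
  by rewrite !permX !(wfix_transport _ _ fx, wfix_transport _ _ ux) ej.
rewrite -(card_in_imset phi_inj) -[RHS](card_pffun_on None (mem B) predT).
apply: eq_card => v; apply/imsetP/pffun_onP => [[f fx ->]|[vB _]].
  split=> [|o _] //; apply/fintype.subsetP => C; rewrite inE ffunE.
  by case: (C \in B).
have v0 C : C \notin B -> v C = None.
  by move=> CB; apply/eqP; apply: contraNT CB => vC; apply: (fintype.subsetP vB).
pose r i := orep (porbit x.2 i) i.
have rO i : porbit x.2 (r i) = porbit x.2 i by exact/porbit_mem/orep_porbit.
have rE i j : porbit x.2 i = porbit x.2 j -> r i = r j.
  by move=> e; rewrite /r e; apply: (@orep_irr _ _ _ _ j); rewrite porbit_id.
have ri i : iter (oidx x.2 i) x.2 (r i) = i by exact: oidxE.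
pose f : config := [ffun i => oact (transport x (r i) (oidx x.2 i)) (v (porbit x.2 i))].
exists f.
  apply/wfixP => k; rewrite !ffunE (porbit_iter x.2 1 k).
  have [h|h] := eqVneq (holonomy x (r k)) 1%g; last first.
    by rewrite v0 // -rO BE.
  rewrite -oactM (rE _ _ (porbit_iter x.2 1 k)); congr oact.
  have e : iter (oidx x.2 (x.2 k)) x.2 (r k) = iter (oidx x.2 k).+1 x.2 (r k).
    by rewrite [RHS]iterS ri -(rE _ _ (porbit_iter x.2 1 k)) ri.
  by rewrite (balanced_transport h e) /= ri.
apply/ffunP => C; rewrite ffunE; case: ifPn => [CB|/v0] //.
have [i eC] := cycles_in_porbit CB; rewrite eC in CB *.
have -> : [pick k in porbit x.2 i] = Some (r i).
  by rewrite /r /orep; case: pickP => // /(_ i); rewrite porbit_id.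
rewrite ffunE rO (rE _ _ (rO i)).
have h : holonomy x (r i) = 1%g by apply/eqP; rewrite -BE rO.
have e : iter (oidx x.2 (r i)) x.2 (r i) = iter 0 x.2 (r i).
  by rewrite -{2}(rE _ _ (rO i)) ri.
by rewrite (balanced_transport h e) oact1.
Qed.

Lemma fiber_bound (F F' : {set config}) (k : 'I_n) (Phi : config -> config) :
  {in F, forall f, Phi f \in F'} ->
  {in F &, forall f u, f k = u k -> Phi f = Phi u -> f = u} ->
  (#|F| <= #|{: option gT}| * #|F'|)%N.
Proof.
move=> FF' inj; pose P f := (f k, Phi f).
have Pinj : {in F &, injective P} by move=> f u Ff Fu [e1 e2]; exact: inj.
rewrite -(card_in_imset Pinj) -cardsT -cardsX; apply/subset_leq_card/fintype.subsetP.
by move=> _ /imsetP[f Ff ->]; rewrite !inE /= FF'.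
Qed.

Definition zeroing x i f : config := [ffun k => if k \in porbit x.2 i then None else f k].

Lemma mem_porbit_step x i k : (x.2 k \in porbit x.2 i) = (k \in porbit x.2 i).
Proof. by rewrite -!eq_porbit_mem (porbit_iter x.2 1 k). Qed.

Lemma zeroing_fix x i f : f \in wfix x -> zeroing x i f \in wfix x.
Proof.
move=> /wfixP fx; apply/wfixP => k; rewrite !ffunE mem_porbit_step.
by case: ifP => // _; apply: fx.
Qed.

Lemma zeroing_inj x i f u : f \in wfix x -> u \in wfix x -> f i = u i ->
  zeroing x i f = zeroing x i u -> f = u.
Proof.
move=> fx ux e /ffunP ez; apply/ffunP => k; have := ez k; rewrite !ffunE.
case: ifP => // /porbitP[m ->] _.
by rewrite permX !(wfix_transport _ _ fx, wfix_transport _ _ ux) e.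
Qed.

Lemma cond2_bound x i :
  (#|wfix x| <= #|{: option gT}| * #|[set f in wfix x | f i == None]|)%N.
Proof.
apply: (@fiber_bound _ _ i (zeroing x i)) => [f fx|f u fx ux]; last exact: zeroing_inj.
by rewrite inE zeroing_fix //= ffunE porbit_id.
Qed.

Lemma cond1_bound x i j c :
  (#|wfix x| <= #|{: option gT}| * #|[set f in wfix x | f j == oact c (f i)]|)%N.
Proof.
have easy : (j \in porbit x.2 i) || [forall f in wfix x, f j == None] ->
  (#|wfix x| <= #|{: option gT}| * #|[set f in wfix x | f j == oact c (f i)]|)%N.
  move=> h; apply: (@fiber_bound _ _ i (zeroing x i)) => [f fx|f u fx ux]; last exact: zeroing_inj.
  rewrite inE zeroing_fix //= !ffunE porbit_id /=.
  case: ifP h => //= _ /forall_inP h; exact: h.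
have [//|] := boolP ((j \in porbit x.2 i) || [forall f in wfix x, f j == None]).
rewrite negb_or => /andP[ji /forall_inPn[u ux]] {easy}.
case euj : (u j) => [b|//] _.
have ij : i \notin porbit x.2 j by rewrite porbit_sym.
pose rm (o : option gT) (d : option gT) := if o is Some a then oact (a * b^-1 * c)%g d else None.
pose Phi f : config := [ffun k => if k \in porbit x.2 j then rm (u k) (f i) else f k].
apply: (@fiber_bound _ _ j Phi) => [f fx|f v fx vx e /ffunP eP].
  rewrite inE !ffunE porbit_id (negPf ij) euj /= mulgV mul1g eqxx andbT.
  apply/wfixP => k; rewrite !ffunE mem_porbit_step; case: ifP => _; last exact: (wfixP _ _ fx).
  rewrite (wfixP _ _ ux); case: (u k) => //= a.
  by rewrite -oactM !mulgA.
apply/ffunP => k; have := eP k; rewrite !ffunE.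
case: ifP => // /porbitP[m ->] _.
by rewrite permX !(wfix_transport _ _ fx, wfix_transport _ _ vx) e.
Qed.

Lemma q_gt1 : (1 < #|{: option gT}|)%N.
Proof. by rewrite card_option ltnS; apply/card_gt0P; exists 1%g. Qed.

Lemma nbal_reflection r (Q : wreath gT n -> {set config}) :
  (forall z, #|wfix z| <= #|{: option gT}| * #|Q z|)%N ->
  (forall z, {subset Q z <= wfix z :&: wfix r}) ->
  forall z, (nbal z <= (nbal (r * z)%g).+1)%N.
Proof.
move=> Qq Qs z; rewrite -(leq_exp2l _ _ q_gt1) expnS -!card_wfix.
apply: leq_trans (Qq z) _; rewrite leq_mul2l; apply/orP; right.
apply/subset_leq_card/fintype.subsetP => f /Qs; rewrite inE => /andP[fz fr].
exact: wfixM.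
Qed.

Definition point i : config := [ffun k => if k == i then Some 1%g else None].

Lemma reflection_ex x : x != 1%g -> exists r,
  [/\ {subset wfix x <= wfix r},
      exists i, wact x (point i) = wact r (point i) /\ point i \notin wfix x &
      forall z, (nbal z <= (nbal (r * z)%g).+1)%N].
Proof.
have [/eqP|[i /= si]] : x.2 = 1%g \/ exists i, x.2 i != i.
- case: (boolP [exists i, x.2 i != i]) => [/existsP|]; first by right.
  rewrite negb_exists => /forallP h; left; apply/permP => i.
  by rewrite perm1; apply/eqP; rewrite -[_ == _]negbK.
- move=> /eqP x2 x1.
  have [i gi] : exists i, x.1 i != 1%g.
    apply/existsP; apply: contraNT x1; rewrite negb_exists => /forallP h.
    apply/eqP; rewrite [x]surjective_pairing x2; congr (_, _).
    by apply/ffunP => i; rewrite ffunE; apply/eqP; rewrite -[_ == _]negbK.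
  pose r : wreath gT n := ([ffun k => if k == i then x.1 i else 1%g], 1%g).
  have rf f : f i = None -> f \in wfix r.
    move=> fi; apply/wfixP => k; rewrite /= perm1 ffunE.
    by case: eqP => [->|_]; rewrite ?fi ?oact1.
  have xf f : f \in wfix x -> f i = None.
    move=> /wfixP/(_ i); rewrite x2 perm1; case: (f i) => //= a [e].
    by rewrite (mulIg a (x.1 i) 1%g) ?eqxx // mul1g in gi.
  exists r; split=> [f /xf /rf //||].
    exists i; split; last by apply/negP => /xf; rewrite ffunE eqxx.
    apply/ffunP => k; rewrite !ffunE /= x2 invg1 perm1.
    by case: eqP => [->|].
  apply: (@nbal_reflection _ (fun z => [set f in wfix z | f i == None])) => z.
    exact: cond2_bound.
  by move=> f; rewrite !inE => /andP[-> /eqP/rf]; rewrite inE.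
move=> _; pose j := x.2 i; pose c := x.1 j.
have ij : i != j by rewrite eq_sym.
pose r : wreath gT n :=
  ([ffun k => if k == j then c else if k == i then c^-1%g else 1%g], tperm i j).
have rf f : f j = oact c (f i) -> f \in wfix r.
  move=> fj; apply/wfixP => k; rewrite /= !ffunE.
  case: tpermP => [->|->|/eqP/negPf ki /eqP/negPf kj]; rewrite ?eqxx ?(negPf ij) //.
    by rewrite fj -oactM mulVg oact1.
  by rewrite ki kj oact1.
exists r; split=> [f /wfixP/(_ i) /rf //||].
  exists i; split; last first.
    apply/negP => /wfixP/(_ i); rewrite !ffunE eqxx.
    by rewrite (negPf si).
  apply/ffunP => k; rewrite !ffunE /= tpermV.
  have -> : (x.2^-1%g k == i) = (k == j).
    by rewrite -(inj_eq (@perm_inj _ x.2)) permKV.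
  have -> : (tperm i j k == i) = (k == j).
    by rewrite -(inj_eq (@perm_inj _ (tperm i j))) tpermK tpermL.
  by case: (eqVneq k j) => [->|].
apply: (@nbal_reflection _ (fun z => [set f in wfix z | f j == oact c (f i)])) => z.
  exact: cond1_bound.
by move=> f; rewrite !inE => /andP[-> /eqP/rf]; rewrite inE.
Qed.

Lemma nbal_le x : (nbal x <= n)%N.
Proof. by rewrite -{2}(norm_nbal x) leq_addl. Qed.

Lemma nbal_mul x y : (nbal x + nbal y <= n + nbal (x * y)%g)%N.
Proof.
have [d] := ubnP (n - nbal x)%N; elim: d x => // d IH x dx.
have [->|/reflection_ex[r [xr [i [ei ix]] rP]]] := eqVneq x 1%g.
  by rewrite mul1g leq_add2r nbal_le.
pose x' := (r^-1 * x)%g; have xE : x = (r * x')%g by rewrite mulKVg.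
have lt_x : (nbal x < nbal x')%N.
  rewrite -(ltn_exp2l _ _ q_gt1) -!card_wfix; apply: proper_card.
  apply/properP; split.
    by apply/fintype.subsetP => f fx; apply: wfixM => //; apply/wfixV/xr.
  by exists (point i) => //; rewrite inE wactM ei -wactM mulVg wact1.
have h : (nbal x' + nbal y <= n + nbal (x' * y)%g)%N.
  apply: IH; apply: leq_trans (ltnSE dx); apply: ltn_sub2l => //.
  exact: leq_trans lt_x (nbal_le _).
rewrite -ltnS -addSn -addnS {2}xE -mulgA.
apply: leq_trans (leq_trans h _); first by rewrite leq_add2r.
by rewrite leq_add2l.
Qed.

Lemma norm_mul x y :
  (partn_norm (modified_type (x * y)%g) <=
   partn_norm (modified_type x) + partn_norm (modified_type y))%N.
Proof.
have := nbal_mul x y; have := norm_nbal x; have := norm_nbal y; have := norm_nbal (x * y)%g.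
move=> exy ey ex h; rewrite -(leq_add2r (nbal x + nbal y)) addnACA ex ey.
apply: leq_trans (leq_add (leqnn _) h) _.
by rewrite addnCA exy.
Qed.

Lemma norm1 : partn_norm (modified_type (1 : wreath gT n)%g) = 0%N.
Proof.
apply/eqP; rewrite -leqn0 -(leq_add2r (nbal (1%g : wreath gT n))) norm_nbal add0n.
rewrite -(leq_exp2l _ _ q_gt1) -card_wfix.
have -> : wfix 1%g = [set: config] by apply/setP => f; rewrite !inE wact1 eqxx.
by rewrite cardsT card_ffun card_ord.
Qed.
End Subadditivity.
Section FarahatHigman.
Variables (gT : finGroupType) (n : nat).
Local Notation Gn := (wreath gT n).
Local Notation Rn := (group_ring_center Gn).

Definition type_sum (lam : partn_fun gT) : group_ring Gn :=
  \sum_(x : Gn | modified_type x == lam) gr_delta x.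

Lemma type_sumE lam x : type_sum lam x = (modified_type x == lam)%:R.
Proof.
rewrite /type_sum sum_ffunE big_mkcond (bigD1 x) //= ffunE eqxx.
rewrite big1 ?addr0; first by case: ifP.
move=> y /negPf yx; case: ifP => // _.
by rewrite ffunE eq_sym yx.
Qed.

Lemma type_sum_central lam : type_sum lam \in @central Gn.
Proof. by apply/central_classfun => x y; rewrite !type_sumE modified_typeJ. Qed.

Definition classK lam : Rn := GroupRingCenter (type_sum_central lam).

(* The Z-span of the K_lam(n) with ||lam|| <= k. *)
Definition norm_piece k : {pred Rn} := fun u =>
  `[< exists (s : seq (partn_fun gT)) (a : partn_fun gT -> int),
        all (fun lam => partn_norm lam <= k)%N s /\
        u = \sum_(lam <- s) classK lam *~ a lam >].

Definition center_coef (x : Gn) (u : Rn) : int := val u x.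
Lemma center_coef_zmod x : zmod_morphism (center_coef x).
Proof. by move=> u v; rewrite /center_coef raddfB !ffunE. Qed.
HB.instance Definition _ x :=
  GRing.isZmodMorphism.Build Rn int (center_coef x) (center_coef_zmod x).

Lemma center_coefP (u v : Rn) : (forall x, center_coef x u = center_coef x v) -> u = v.
Proof. by move=> e; apply/val_inj/ffunP => x; apply: e. Qed.

Lemma center_coefK x lam :
  center_coef x (classK lam) = (modified_type x == lam)%:R.
Proof. exact: type_sumE. Qed.

Lemma center_coef_span (s : seq (partn_fun gT)) (a : partn_fun gT -> int) x :
  center_coef x (\sum_(lam <- s) classK lam *~ a lam) =
  \sum_(lam <- s | lam == modified_type x) a lam.
Proof.
rewrite raddf_sum [RHS]big_mkcond; apply: eq_bigr => lam _.
rewrite raddfMz /= center_coefK eq_sym.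
by case: eqP => _; rewrite /= ?mul0rz // intz.
Qed.

Lemma norm_pieceP k (u : Rn) :
  reflect (forall x, center_coef x u != 0 ->
                     (partn_norm (modified_type x) <= k)%N)
          (u \in norm_piece k).
Proof.
apply: (iffP (asboolP _)) => [[s [a [/allP sk ->]]] x|h].
  apply: contraNT => xk; rewrite center_coef_span big_seq_cond big1 //.
  by move=> lam /andP[/sk lk /eqP e]; rewrite -e lk in xk.
pose s := undup [seq modified_type x | x <- enum {: Gn} & center_coef x u != 0].
pose a lam := if [pick x | modified_type x == lam] is Some x then center_coef x u else 0.
have aE x : a (modified_type x) = center_coef x u.
  rewrite /a; case: pickP => [z /eqP/same_type_conj[y ->]|/(_ x)]; last by rewrite eqxx.
  by rewrite /center_coef (central_classfun _ (valP u)).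
exists s, a; split.
  apply/allP => lam; rewrite mem_undup => /mapP[x]; rewrite mem_filter => /andP[ux _] ->.
  exact: h.
apply: center_coefP => x; rewrite center_coef_span.
have [ux|ux] := eqVneq (center_coef x u) 0.
  rewrite big_seq_cond big1 // => lam /andP[_ /eqP ->].
  by rewrite aE.
rewrite -big_filter (_ : [seq _ <- s | _] = [:: modified_type x]) ?big_seq1 ?aE //.
rewrite filter_pred1_uniq ?undup_uniq // mem_undup map_f //.
by rewrite mem_filter ux mem_enum.
Qed.

Lemma norm_piece_zmod k : zmod_closed (norm_piece k).
Proof.
split=> [|u v /norm_pieceP hu /norm_pieceP hv]; apply/norm_pieceP => x.
  by rewrite raddf0 eqxx.
rewrite raddfB /=; have [->|/hu //] := eqVneq (center_coef x u) 0.
by rewrite sub0r oppr_eq0 => /hv.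
Qed.

Lemma norm_pieceS k : {subset norm_piece k <= norm_piece k.+1}.
Proof.
move=> u /norm_pieceP hu; apply/norm_pieceP => x /hu h.
exact: leqW.
Qed.

Lemma norm_piece1 : 1 \in norm_piece 0.
Proof.
apply/norm_pieceP => x; rewrite /center_coef rmorph1 ffunE.
by have [->|_] := eqVneq x 1%g; rewrite ?norm1 ?eqxx.
Qed.

Lemma norm_pieceM i j (u v : Rn) :
  u \in norm_piece i -> v \in norm_piece j -> u * v \in norm_piece (i + j)%N.
Proof.
move=> /norm_pieceP hu /norm_pieceP hv; apply/norm_pieceP => x.
rewrite /center_coef rmorphM {1}/GRing.mul /= ffunE => h.
have [y] : exists y, center_coef y u * center_coef (y^-1 * x)%g v != 0.
  apply/existsP; apply: contraNT h; rewrite negb_exists => /forallP h.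
  by rewrite big1 // => y _; apply/eqP; rewrite -[_ == _]negbK h.
rewrite mulf_eq0 negb_or => /andP[/hu iy /hv jy].
rewrite -(mulKVg y x); apply: leq_trans (norm_mul _ _) _.
exact: leq_add.
Qed.

Definition norm_filtration : filtration Rn :=
  Filtration norm_piece_zmod norm_pieceS norm_piece1 norm_pieceM.

Lemma classK_piece lam : classK lam \in norm_filtration (partn_norm lam).
Proof.
apply/norm_pieceP => x; rewrite center_coefK.
by case: (eqVneq (modified_type x) lam) => [->|].
Qed.

Definition gradedFH : Type := assoc_graded norm_filtration.
HB.instance Definition _ := GRing.ComNzRing.on gradedFH.

Definition gradedK lam : gradedFH := graded_class (classK_piece lam).

End FarahatHigman.

(* Finitely supported sums over the partition-valued functions of a given norm
   are thus ordinary finite sums. *)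
Lemma partn_norm_finite (gT : finGroupType) (d : nat) :
  finite_set [set nu : partn_fun gT | partn_norm nu = d]%classic.
Proof.
pose W := {ffun conj_class gT -> {ffun 'I_d -> 'I_d.+1}}.
pose f (w : W) : partn_fun gT :=
  [ffun c => to_partn [seq val (w c i) | i <- enum 'I_d]].
apply: (@sub_finite_set _ _ (f @` [set: W])%classic); last first.
  exact/finite_image/finite_finset.
move=> nu /= nud; pose s c : seq nat := nu c.
have sum_le c : (sumn (s c) <= d)%N by rewrite -nud /partn_norm (bigD1 c) //= leq_addr.
have s0 c : 0%N \notin s c by rewrite /s; case: (nu c) => t /= /andP[].
have part_le c k : k \in s c -> (k <= d)%N.
  move=> ks; apply: leq_trans (sum_le c); elim: (s c) ks => //= a t IH.
  rewrite inE => /orP[/eqP <-|/IH h]; first exact: leq_addr.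
  exact: leq_trans h (leq_addl _ _).
have size_le c : (size (s c) <= d)%N.
  apply: leq_trans (sum_le c); have := s0 c; elim: (s c) => //= -[|a] t IH //.
  rewrite inE /= => /IH h; rewrite addSn ltnS; exact: leq_trans h (leq_addl _ _).
exists [ffun c => [ffun i : 'I_d => inord (nth 0%N (s c) i)]] => //.
apply/ffunP => c; rewrite !ffunE.
rewrite (_ : [seq _ | i <- enum 'I_d] = mkseq (nth 0%N (s c)) d); last first.
  rewrite /mkseq -val_enum_ord -map_comp; apply: eq_map => i /=.
  rewrite ffunE inordK // ltnS; case: (ltnP i (size (s c))) => h.
    by apply: (@part_le c); exact: mem_nth.
  by rewrite nth_default.
have e : perm_eq (to_partn (mkseq (nth 0%N (s c)) d)) (s c).
  apply: perm_trans (parts_to_partn _) _.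
  have -> : mkseq (nth 0%N (s c)) d = s c ++ nseq (d - size (s c)) 0%N.
    apply: (@eq_from_nth _ 0%N); first by rewrite size_mkseq size_cat size_nseq subnKC.
    move=> i; rewrite size_mkseq => id; rewrite nth_mkseq // nth_cat nth_nseq if_same.
    by case: ltnP => // h; rewrite nth_default.
  by rewrite filter_cat filter_pos // (_ : filter _ (nseq _ _) = [::]) ?cats0 //; elim: (d - _)%N.
apply: val_inj; apply: (sorted_eq (leT := geq)) e.
- by move=> a b k ba kb; exact: leq_trans kb ba.
- by move=> a b /andP[ba ab]; apply: anti_leq; apply/andP.
- by case: (to_partn _) => t /= /andP[].
- by rewrite /s; case: (nu c) => t /= /andP[].
Qed.

(* Main.v *)
Require Import Defs.
From mathcomp Require Import all_boot all_order all_fingroup all_algebra.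
From mathcomp Require Import boolp classical_sets cardinality fsbigop.
Set Implicit Arguments. Unset Strict Implicit. Unset Printing Implicit Defensive.
Import GRing.Theory.
Local Open Scope ring_scope.

(** The coefficient of an element x of the wreath product Gamma_n in
    K_lam(n) K_mu(n) is the number of factorizations x = y z with y of modified
    type lam and z of modified type mu ([center_coefM]). It vanishes when
    ||x|| > ||lam|| + ||mu|| because the norm is subadditive, and in degree
    ||lam|| + ||mu|| of the associated graded ring only the x with
    ||x|| = ||lam|| + ||mu|| matter. It remains to see that, for those x, the
    number of factorizations depends on the modified type nu of x but not on n.

    Say that k is a trivial point of x = (g, s) if s fixes k and g_k = 1. The
    main point is that when ||y z|| = ||y|| + ||z||, a trivial point k of y z is
    a trivial point of y and of z ([additive_point], [additive_point_left]).
    Otherwise z maps k to some j with a label c, and the reflection r that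
    carries k to j with label c satisfies y z = (y r) (r^-1 z). Every
    configuration fixed by z is fixed by r^-1 z, which is moreover trivial at k,
    so r^-1 z fixes more configurations and ||r^-1 z|| < ||z||; since y undoes
    what z does to k, also ||y r|| <= ||y||. This contradicts subadditivity.

    The embedding [wr_lift] of Gamma_n in Gamma_(n+1), which adds a trivial
    point, preserves modified types, and its image is the stabilizer of that
    point. Hence the relevant factorizations of the image of x are exactly the
    images of the factorizations of x, so their number is unchanged
    ([fact_number_lift]). As elements of Gamma_n of the same modified type are
    conjugate, the number depends on nu only ([fact_number_stable]). *)

(** * Trivial points and norm-additive products *)

Section TrivialPoints.
Variables (gT : finGroupType) (n : nat).
Implicit Types x y : wreath gT n.

Lemma wact_point x k :
  wact x (Defs.point gT k) =
  [ffun i => if i == x.2 k then Some (x.1 (x.2 k)) else None].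
Proof.
apply/ffunP => i; rewrite !ffunE.
have -> : (x.2^-1%g i == k) = (i == x.2 k) by rewrite -(inj_eq (@perm_inj _ x.2)) permKV.
by case: eqP => [->|] //=; rewrite mulg1.
Qed.

(** [Defs.point gT k] is the configuration with value 1 at k and 0 elsewhere;
    it is fixed by x exactly when k is a trivial point of x. *)
Lemma point_wfix x k : (Defs.point gT k \in wfix x) = (x.2 k == k) && (x.1 k == 1%g).
Proof.
rewrite inE wact_point; apply/eqP/andP => [/ffunP e|[/eqP xk /eqP gk]].
  have := e (x.2 k); rewrite !ffunE eqxx; case: eqP => // xk.
  by rewrite xk => -[->].
by apply/ffunP => i; rewrite !ffunE xk gk.
Qed.

(** The reflection that carries k to j with label c, and j back to k with label
    c^-1; it fixes every configuration f with f_j = c f_k. For j = k this is the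
    element with trivial permutation and with the label c at k: the test
    against j comes first. *)
Definition reflection (k j : 'I_n) (c : gT) : wreath gT n :=
  ([ffun i => if i == j then c else if i == k then c^-1%g else 1%g], tperm k j).

Lemma reflection_wfix k j c (f : config gT n) :
  f j = oact c (f k) -> f \in wfix (reflection k j c).
Proof.
move=> fj; apply/wfixP => i; rewrite /= !ffunE.
case: tpermP => [->|->|/eqP/negPf ik /eqP/negPf ij]; rewrite ?eqxx //.
  by case: eqP => [kj|_]; [rewrite -kj in fj * | rewrite fj -oactM mulVg oact1].
by rewrite ik ij oact1.
Qed.

Lemma wfix_sub_reflection x k :
  {subset wfix x <= wfix (reflection k (x.2 k) (x.1 (x.2 k)))}.
Proof. by move=> f /wfixP fx; apply: reflection_wfix. Qed.

Lemma wact_reflection_point k j c :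
  wact (reflection k j c) (Defs.point gT k) = [ffun i => if i == j then Some c else None].
Proof. by rewrite wact_point /= tpermL ffunE eqxx. Qed.

Lemma nbal_subset x y : {subset wfix x <= wfix y} -> (nbal x <= nbal y)%N.
Proof.
move=> /fintype.subsetP/subset_leq_card.
by rewrite !card_wfix leq_exp2l // q_gt1.
Qed.

Lemma nbal_proper x y f : {subset wfix x <= wfix y} ->
  f \in wfix y -> f \notin wfix x -> (nbal x < nbal y)%N.
Proof.
move=> /fintype.subsetP xy fy fx; rewrite -(ltn_exp2l _ _ (q_gt1 gT)) -!card_wfix.
by apply: proper_card; apply/properP; split=> //; exists f.
Qed.

(** When the norm of x y is the sum of the norms of x and y, the factor y is
    trivial at every point where x y is. *)
Lemma additive_point x y k :
  partn_norm (modified_type (x * y)%g) =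
    (partn_norm (modified_type x) + partn_norm (modified_type y))%N ->
  Defs.point gT k \in wfix (x * y)%g -> Defs.point gT k \in wfix y.
Proof.
move=> exy pxy; apply: contraT => py.
pose r := reflection k (y.2 k) (y.1 (y.2 k)).
(* r and y agree at k, and x^-1 agrees with them because x y is trivial at k. *)
have ry : wact r (Defs.point gT k) = wact y (Defs.point gT k).
  by rewrite wact_reflection_point wact_point.
have xV : wact x^-1%g (Defs.point gT k) = wact y (Defs.point gT k).
  move: pxy; rewrite inE wactM => /eqP e.
  by rewrite -{1}e -wactM mulVg wact1.
have rx : reflection k (x^-1%g.2 k) (x^-1%g.1 (x^-1%g.2 k)) = r.
  have := xV; rewrite !wact_point => /ffunP/(_ (x^-1%g.2 k)).
  by rewrite !ffunE eqxx; case: eqP => // e [->]; rewrite e.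
(* The factorization x y = (x r) (r^-1 y) has a strictly smaller total norm,
   that is, a strictly larger total number of balanced cycles. *)
have le_x : (nbal x <= nbal (x * r)%g)%N.
  apply: nbal_subset => f fx; apply: wfixM => //.
  by rewrite -rx; apply/wfix_sub_reflection/wfixV.
have lt_y : (nbal y < nbal (r^-1 * y)%g)%N.
  apply: (nbal_proper _ _ py) => [f fy|].
    by apply: wfixM => //; apply/wfixV/wfix_sub_reflection.
  by rewrite inE wactM -ry -wactM mulVg wact1.
have := nbal_mul (x * r)%g (r^-1 * y)%g; rewrite mulgA mulgK => h.
have := leq_trans (leq_add le_x lt_y) h.
have := norm_nbal x; have := norm_nbal y; have := norm_nbal (x * y)%g.
rewrite exy => exy' ey ex.
rewrite -(leq_add2l (partn_norm (modified_type x) + partn_norm (modified_type y))).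
by rewrite addnACA addnS ex ey addnCA exy' addnS ltnn.
Qed.

Lemma additive_point_left x y k :
  partn_norm (modified_type (x * y)%g) =
    (partn_norm (modified_type x) + partn_norm (modified_type y))%N ->
  Defs.point gT k \in wfix (x * y)%g -> Defs.point gT k \in wfix x.
Proof.
move=> exy pxy; rewrite -(mulgK y x); apply: wfixM => //.
exact/wfixV/additive_point/pxy.
Qed.
End TrivialPoints.

(** * Adding a trivial point *)

Section Stabilization.
Variables (gT : finGroupType) (n : nat).
Implicit Types x y : wreath gT n.

(** The embedding of Gamma_n in Gamma_(n+1) that adds a trivial point. The new
    point is [ord0]; the old points are shifted by [lift ord0]. *)
Definition wr_lift x : wreath gT n.+1 :=
  ([ffun i => if unlift ord0 i is Some j then x.1 j else 1%g],
   lift_perm ord0 ord0 x.2).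

Lemma wr_lift1 x i : (wr_lift x).1 (lift ord0 i) = x.1 i.
Proof. by rewrite ffunE liftK. Qed.

Lemma wr_lift2 x i : (wr_lift x).2 (lift ord0 i) = lift ord0 (x.2 i).
Proof. exact: lift_perm_lift. Qed.

Lemma wr_liftM x y : wr_lift (x * y)%g = (wr_lift x * wr_lift y)%g.
Proof.
have e2 : (wr_lift (x * y)%g).2 = (wr_lift x * wr_lift y)%g.2 by rewrite /= lift_permM.
rewrite [LHS]surjective_pairing [RHS]surjective_pairing e2; congr pair.
apply/ffunP => i; rewrite wrM1 !ffunE /= lift_permV.
case: (unliftP ord0 i) => [j ->|->]; last by rewrite lift_perm_id unlift_none mulg1.
by rewrite lift_perm_lift liftK ffunE.
Qed.

Lemma wr_lift_inj : injective wr_lift.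
Proof.
move=> x y e; rewrite [x]surjective_pairing [y]surjective_pairing; congr pair.
  by apply/ffunP => i; rewrite -!wr_lift1 e.
by apply/permP => i; apply: (@lift_inj _ ord0); rewrite -!wr_lift2 e.
Qed.

Lemma wr_lift_point x : Defs.point gT ord0 \in wfix (wr_lift x).
Proof. by rewrite point_wfix /= lift_perm_id ffunE unlift_none !eqxx. Qed.

(** The image of the embedding is the stabilizer of the new point. *)
Lemma wr_lift_surj (w : wreath gT n.+1) :
  Defs.point gT ord0 \in wfix w -> exists x, w = wr_lift x.
Proof.
rewrite point_wfix => /andP[/eqP w2 /eqP w1].
pose p i := odflt i (unlift ord0 (w.2 (lift ord0 i))).
have pE i : lift ord0 (p i) = w.2 (lift ord0 i).
  rewrite /p; case: unliftP => [j -> //|] /=.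
  by rewrite -{2}w2 => /perm_inj e; have := neq_lift ord0 i; rewrite e eqxx.
have p_inj : injective p.
  by move=> i j e; apply: (@lift_inj _ ord0); apply: (@perm_inj _ w.2); rewrite -!pE e.
exists ([ffun i => w.1 (lift ord0 i)], perm p_inj).
rewrite [LHS]surjective_pairing; congr pair.
  by apply/ffunP => i; rewrite ffunE; case: unliftP => [j ->|->]; rewrite ?ffunE.
apply/permP => i; case: (unliftP ord0 i) => [j ->|->]; last by rewrite lift_perm_id.
by rewrite lift_perm_lift permE pE.
Qed.

Lemma wr_lift_iter x i m :
  iter m (wr_lift x).2 (lift ord0 i) = lift ord0 (iter m x.2 i).
Proof. by elim: m => //= m ->; rewrite -wr_lift2. Qed.

Lemma wr_lift_transport x i m :
  transport (wr_lift x) (lift ord0 i) m = transport x i m.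
Proof.
elim: m => // m IH.
by rewrite [LHS]/= -[X in (wr_lift x).1 X]/(iter m.+1 _ _) wr_lift_iter wr_lift1 IH.
Qed.

Lemma wr_lift_porbit x i :
  porbit (wr_lift x).2 (lift ord0 i) = lift ord0 @: porbit x.2 i.
Proof.
apply/setP => j; apply/porbitP/imsetP => [[m ->]|[k /porbitP[m ->] ->]].
  by exists ((x.2 ^+ m)%g i); rewrite ?mem_porbit // !permX wr_lift_iter.
by exists m; rewrite !permX wr_lift_iter.
Qed.

Lemma wr_lift_porbit0 x : porbit (wr_lift x).2 ord0 = [set ord0].
Proof.
apply/setP => j; rewrite inE; apply/porbitP/eqP => [[m ->]|->]; last first.
  by exists 0%N; rewrite perm1.
by rewrite permX; elim: m => //= m ->; rewrite lift_perm_id.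
Qed.

Lemma wr_lift_hclass x i : hclass (wr_lift x) (lift ord0 i) = hclass x i.
Proof.
apply: val_inj => /=.
by rewrite /holonomy wr_lift_porbit card_imset ?wr_lift_transport //; exact: lift_inj.
Qed.

Lemma wr_lift_hclass0 x : hclass (wr_lift x) ord0 = class1 gT.
Proof.
apply/eqP; rewrite hclass1 /holonomy wr_lift_porbit0 cards1 /= lift_perm_id.
by rewrite ffunE unlift_none mulg1.
Qed.

Lemma wr_lift_cycles x c :
  cycles_in (wr_lift x) c =
  (if c == class1 gT then [set [set ord0]] else finset.set0) :|:
  (fun C : {set 'I_n} => lift ord0 @: C) @: cycles_in x c.
Proof.
have h0 : ([set ord0] \in cycles_in (wr_lift x) c) = (c == class1 gT).
  by rewrite -(wr_lift_porbit0 x) cycles_inE wr_lift_hclass0 eq_sym.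
apply/setP => C; apply/idP/idP => [Cx|].
  have [i eC] := cycles_in_porbit Cx; move: Cx; rewrite eC.
  case: (unliftP ord0 i) => [j ->|->].
    rewrite cycles_inE wr_lift_hclass => jc; rewrite inE; apply/orP; right.
    by apply/imsetP; exists (porbit x.2 j); rewrite ?wr_lift_porbit ?cycles_inE.
  by rewrite wr_lift_porbit0 h0 => ->; rewrite !inE eqxx.
rewrite inE => /orP[|/imsetP[D Dx ->]].
  by rewrite -h0; case: ifP => [+|_]; rewrite ?inE // => h /eqP ->.
have [i eD] := cycles_in_porbit Dx; move: Dx; rewrite eD -wr_lift_porbit.
by rewrite !cycles_inE wr_lift_hclass.
Qed.

Lemma wr_lift_cycle_sizes x c :
  perm_eq [seq #|C| | C : {set 'I_n.+1} in cycles_in (wr_lift x) c]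
          (nseq (c == class1 gT) 1%N ++ [seq #|C| | C : {set 'I_n} in cycles_in x c]).
Proof.
set L := fun C : {set 'I_n} => lift ord0 @: C.
have L_inj : injective L by apply: imset_inj; exact: lift_inj.
have e (C : {set 'I_n}) : #|L C| = #|C| by rewrite card_imset //; exact: lift_inj.
have : perm_eq (enum (cycles_in (wr_lift x) c))
    (nseq (c == class1 gT) [set ord0] ++ [seq L C | C in cycles_in x c]).
  apply: uniq_perm; rewrite ?enum_uniq //.
    rewrite cat_uniq (map_inj_uniq L_inj) enum_uniq andbT.
    case: eqP => _ /=; last by rewrite has_pred0.
    apply/hasPn => C /mapP[D _ ->]; rewrite /= inE; apply/eqP => /setP/(_ ord0); rewrite !inE eqxx.
    by move=> /imsetP[i _ /eqP]; rewrite eq_liftF.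
  move=> C; rewrite mem_enum wr_lift_cycles inE mem_cat; congr orb.
    by case: eqP => _; rewrite !inE.
  apply/imsetP/mapP => -[D Dx ->]; exists D => //.
    by rewrite mem_enum.
  by rewrite -mem_enum.
move=> /(perm_map (fun C : {set 'I_n.+1} => #|C|)); rewrite map_cat map_nseq cards1.
by rewrite -map_comp (eq_map e).
Qed.

(** The new cycle of length 1 and trivial cycle-product becomes a part 0, which
    is discarded from the modified type. *)
Lemma wr_lift_type x : modified_type (wr_lift x) = modified_type x.
Proof.
apply/ffunP => c; rewrite !(ffunE (fun c => if c == _ then _ else _)).
have h := wr_lift_cycle_sizes x c; case: eqP h => [->|_] h; last first.
  by rewrite !ffunE; apply/eqP; rewrite to_partn_perm; exact: perm_filter.
apply/eqP; rewrite to_partn_perm.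
apply: (@perm_trans _ [seq k <- [seq k.-1 | k <- 1%N :: [seq #|C| | C : {set 'I_n} in
   cycles_in x (class1 gT)]] | (0 < k)%N]).
  by apply/perm_filter/perm_map; apply: perm_trans (wr_type_perm _ _) h.
by rewrite /=; apply/perm_filter/perm_map; rewrite perm_sym wr_type_perm.
Qed.
End Stabilization.

(** * Counting factorizations *)

Section Counting.
Variable gT : finGroupType.
Implicit Types lam mu nu : partn_fun gT.

(** The number of factorizations x = y z with y of modified type lam and z of
    modified type mu; z is determined by y. *)
Definition fact_number n lam mu (x : wreath gT n) : nat :=
  #|[set y | (modified_type y == lam) && (modified_type (y^-1 * x)%g == mu)]|.

Lemma fact_numberJ n lam mu (x y : wreath gT n) :
  fact_number lam mu (x ^ y)%g = fact_number lam mu x.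
Proof.
rewrite /fact_number -[RHS](card_imset _ (conjg_inj y)); apply: eq_card => z.
rewrite -[z](conjgKV y); rewrite [RHS](mem_imset _ _ (conjg_inj y)).
by rewrite !inE -conjVg -conjMg !modified_typeJ.
Qed.

Lemma fact_number_lift n lam mu (x : wreath gT n) :
  partn_norm (modified_type x) = (partn_norm lam + partn_norm mu)%N ->
  fact_number lam mu (wr_lift x) = fact_number lam mu x.
Proof.
move=> ex; rewrite /fact_number -[RHS](card_imset _ (@wr_lift_inj gT n)).
have liftV (y : wreath gT n) : (wr_lift y)^-1%g = wr_lift y^-1%g.
  apply: (mulgI (wr_lift y)); rewrite mulgV -wr_liftM mulgV.
  by apply: (mulgI (wr_lift 1%g)); rewrite -wr_liftM !mulg1.
apply: eq_card => z; apply/idP/imsetP => [|[y + ->]]; rewrite !inE; last first.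
  by rewrite liftV -wr_liftM !wr_lift_type.
move=> /andP[/eqP tz /eqP tzx].
have [y ey] : exists y, z = wr_lift y.
  apply: wr_lift_surj; apply: (@additive_point_left _ _ z (z^-1 * wr_lift x)%g).
    by rewrite mulKVg wr_lift_type tz tzx.
  by rewrite mulKVg wr_lift_point.
exists y => //; rewrite inE -tz -tzx ey liftV -wr_liftM !wr_lift_type !eqxx //.
Qed.

(** The number of norm-additive factorizations of x depends neither on the size
    of the wreath product nor on x, but only on the modified type of x. *)
Lemma fact_number_stable lam mu nu m n (x : wreath gT m) (y : wreath gT n) :
  partn_norm nu = (partn_norm lam + partn_norm mu)%N ->
  modified_type x = nu -> modified_type y = nu ->
  fact_number lam mu x = fact_number lam mu y.
Proof.
move=> enu; wlog mn : m n x y / (m <= n)%N => [h|] ex ey.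
  by case: (leqP m n) => [/h|/ltnW/h h']; [apply | apply/esym/h'].
have [x' ex' <-] : exists2 x' : wreath gT n,
    modified_type x' = nu & fact_number lam mu x' = fact_number lam mu x.
  elim: n mn {y ey} => [|n IH].
    by rewrite leqn0 => /eqP m0; subst m; exists x.
  rewrite leq_eqVlt => /orP[/eqP e|/IH[x' tx' cx']].
    by subst m; exists x.
  exists (wr_lift x'); rewrite ?wr_lift_type //.
  by rewrite fact_number_lift // tx' enu.
have [z ->] := same_type_conj (etrans ex' (esym ey)).
by rewrite fact_numberJ.
Qed.

Lemma structure_constants : exists a : partn_fun gT -> partn_fun gT -> partn_fun gT -> nat,
  forall lam mu n (x : wreath gT n),
    partn_norm (modified_type x) = (partn_norm lam + partn_norm mu)%N ->
    fact_number lam mu x = a lam mu (modified_type x).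
Proof.
have h (t : partn_fun gT * partn_fun gT * partn_fun gT) : exists k, forall n (x : wreath gT n),
    partn_norm t.2 = (partn_norm t.1.1 + partn_norm t.1.2)%N ->
    modified_type x = t.2 -> fact_number t.1.1 t.1.2 x = k.
  have [[m [y ty]]|ny] := pselect (exists m (y : wreath gT m), modified_type y = t.2).
    by exists (fact_number t.1.1 t.1.2 y) => n x et tx; apply: fact_number_stable tx ty.
  (* No element of any wreath product has this modified type. *)
  by exists 0%N => n x _ tx; case: ny; exists n, x.
have [a aP] := choice h.
by exists (fun lam mu nu => a (lam, mu, nu)) => lam mu n x ex;
  exact: (aP (lam, mu, modified_type x)).
Qed.

Lemma center_coefM n lam mu (x : wreath gT n) :
  center_coef x (classK n lam * classK n mu) = (fact_number lam mu x)%:R.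
Proof.
rewrite /center_coef rmorphM {1}/GRing.mul /= ffunE /fact_number -sum1_card natr_sum.
rewrite [RHS]big_mkcond; apply: eq_bigr => y _ /=; rewrite !type_sumE inE.
by case: eqP => _; case: eqP => _; rewrite ?mul0r ?mulr0 ?mulr1.
Qed.

Lemma fact_number_norm n lam mu (x : wreath gT n) :
  (partn_norm lam + partn_norm mu < partn_norm (modified_type x))%N ->
  fact_number lam mu x = 0%N.
Proof.
move=> lt; apply/eqP; rewrite cards_eq0; apply/eqP/setP => y; rewrite !inE.
apply/negP => /andP[/eqP ty /eqP tyx]; move: lt.
by rewrite -ty -tyx ltnNge -{1}(mulKVg y x) norm_mul.
Qed.

(** The piece F_(d-1), with the convention F_(-1) = 0, contains the central
    elements supported in norm less than d. *)
Lemma norm_fpiece_pred n d (u : group_ring_center (wreath gT n)) :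
  (forall x, center_coef x u != 0 -> (partn_norm (modified_type x) < d)%N) ->
  u \in fpiece_pred (norm_filtration gT n) d.
Proof.
case: d => [|d] h; last exact/norm_pieceP.
rewrite inE; apply/eqP/center_coefP => x; rewrite raddf0.
by apply/eqP; apply: contraT => /h.
Qed.
End Counting.

Theorem theorem2p17 (gT : finGroupType) :
  exists a : partn_fun gT -> partn_fun gT -> partn_fun gT -> nat,
  forall n : nat, (0 < n)%N ->
  forall lam mu : partn_fun gT,
    gradedK n lam * gradedK n mu =
    \sum_(nu \in [set nu | partn_norm nu = (partn_norm lam + partn_norm mu)%N]%classic)
       gradedK n nu *+ a lam mu nu.
Proof.
have [a aP] := structure_constants gT; exists a => n _ lam mu.
set d := (_ + _)%N; set A := (X in \sum_(_ \in X) _).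
have finA : finite_set A by exact: partn_norm_finite.
rewrite (fsbig_finite _ _ finA) /=; set s := finmap.enum_fset _.
have sA nu : (nu \in s) = (partn_norm nu == d).
  by rewrite /s in_fset_set //; apply/idP/eqP; rewrite inE.
(* K_nu(n) placed in degree ||nu||, before taking the quotient. *)
pose K (nu : partn_fun gT) := Rees (monomial_rees (classK_piece n nu)).
pose D := classK n lam * classK n mu - \sum_(nu <- s) classK n nu *+ a lam mu nu.
have DP : D \in fpiece_pred (norm_filtration gT n) d.
  apply: norm_fpiece_pred => x; apply: contraR; rewrite -leqNgt => dx.
  rewrite /D raddfB raddf_sum /= center_coefM.
  under eq_bigr => nu _ do rewrite raddfMn /= center_coefK.
  have [xs|xs] := boolP (modified_type x \in s).
    rewrite (bigD1_seq (modified_type x)) ?finmap.fset_uniq //= eqxx.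
    rewrite big1 ?addr0 => [|nu /negPf e]; last by rewrite eq_sym e mul0rn.
    by rewrite aP ?subrr //; apply/eqP; rewrite -sA.
  rewrite big_seq_cond big1 => [|nu /andP[nus _]]; last first.
    by case: eqP nus => [<-|_ _]; rewrite ?(negPf xs) ?mul0rn.
  by rewrite fact_number_norm ?subrr // ltn_neqAle dx andbT eq_sym -sA.
(* In degree d the two sides differ by D, in other degrees both vanish. *)
have -> : gradedK n lam * gradedK n mu =
    \pi_(assoc_graded (norm_filtration gT n))%qT (K lam * K mu) by rewrite rmorphM.
have -> : \sum_(nu <- s) gradedK n nu *+ a lam mu nu =
    \pi_(assoc_graded (norm_filtration gT n))%qT (\sum_(nu <- s) K nu *+ a lam mu nu).
  by rewrite rmorph_sum; apply: eq_bigr => nu _; rewrite rmorphMn.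
apply/eqP; rewrite -Quotient.idealrBE; apply/asboolP => k.
rewrite raddfB raddf_sum coefB coef_sum.
under eq_bigr => nu _ do rewrite raddfMn coefMn coefZ coefXn -mulrnAl.
rewrite (eq_big_seq (fun nu => (classK n nu *+ a lam mu nu) * (k == d)%:R)).
  rewrite -big_distrl /= -scalerAl -scalerAr scalerA -exprD coefZ coefXn -mulrBl.
  case: eqP => [->|_]; first by rewrite mulr1.
  by rewrite mulr0 (fpiece_pred_zmod _ k).1.
by move=> nu; rewrite sA => /eqP <-.
Qed.
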